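(* Let $U,V\in\mathcal{U}(n)$ be such that $d_\infty(U,V)<\pi/2$, and let $t\in(0,1)$. Then the set $$\mathcal{M}_t(U,V)=\{W\in\mathcal{U}(n): d_\infty(U,W)=t\,d_\infty(U,V)\ \text{ and }\ d_\infty(W,V)=(1-t)\,d_\infty(U,V)\}$$ is geodesically convex.
   Context: $\mathcal{U}(n)$ is the group of $n\times n$ complex unitary matrices and $\|\cdot\|_\infty$ the spectral (operator) norm. $d_\infty(U,V)$ is the infimum of the lengths $L(\alpha)=\int_0^1\|\dot\alpha(t)\|_\infty dt$ of piecewise smooth curves $\alpha:[0,1]\to\mathcal{U}(n)$ joining $U$ with $V$. The geodesic joining $W_0$ with $W_1$ in $\mathcal{U}(n)$ is $\beta(s)=W_0e^{isZ}$, $s\in[0,1]$, where $Z$ is Hermitian with $\|Z\|_\infty<\pi$ and $e^{iZ}=W_0^*W_1$ (unique when $d_\infty(W_0,W_1)<\pi$). A set $\mathcal M$ is geodesically convex if for all $W_0,W_1\in\mathcal M$ the geodesic $\beta$ joining them satisfies $\beta(s)\in\mathcal M$ for all $s\in[0,1]$. *)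

(* Defs.v *)
From mathcomp Require Import all_boot all_order all_algebra.
From mathcomp Require Import all_classical all_reals all_analysis.
From mathcomp Require Import complex.
Set Implicit Arguments.
Unset Strict Implicit.
Unset Printing Implicit Defensive.
Import Order.TTheory GRing.Theory Num.Theory.
Import numFieldNormedType.Exports.
Import ComplexField.Normc.
Local Open Scope classical_set_scope.
Local Open Scope ring_scope.
Local Open Scope sesquilinear_scope.
Local Open Scope complex_scope.

Definition euclid_norm (R : realType) (n : nat) (v : 'cV[R[i]]_n) : R :=
  Num.sqrt (\sum_i normc (v i 0) ^+ 2).

Definition spectral_norm (R : realType) (n : nat) (A : 'M[R[i]]_n) : R :=
  sup [set euclid_norm (A *m v) | v in [set v : 'cV[R[i]]_n | euclid_norm v <= 1]].

(* [R[i]] is a normed module over itself only, not over [R], so derivatives in a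
   real variable are taken on the real and imaginary parts of each entry; the
   exponential series is summed in the same way. *)
Definition expmx (R : realType) (n : nat) (A : 'M[R[i]]_n) : 'M[R[i]]_n :=
  let S (k : nat) := \sum_(0 <= l < k) (l`!%:R^-1 : R[i]) *: A ^+ l in
  \matrix_(i, j) (limn (fun k => complex.Re (S k i j)) +i* limn (fun k => complex.Im (S k i j))).

Definition curve_derive (R : realType) (n : nat) (a : R -> 'M[R[i]]_n) (t : R) :
    'M[R[i]]_n :=
  \matrix_(i, j) (derive1 (fun u => complex.Re (a u i j)) t +i*
                  derive1 (fun u => complex.Im (a u i j)) t).

Definition smooth_fun (R : realType) (f : R -> R) : Prop :=
  forall (k : nat) (x : R), derivable (derive1n k f) x 1.

Definition smooth_curve (R : realType) (n : nat) (a : R -> 'M[R[i]]_n) : Prop :=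
  forall i j, smooth_fun (fun t => complex.Re (a t i j)) /\ smooth_fun (fun t => complex.Im (a t i j)).

(* Smoothness on a closed piece means having a smooth extension to the line.
   Consecutive closed pieces share an endpoint, so continuity is implied. *)
Definition piecewise_smooth (R : realType) (n : nat) (a : R -> 'M[R[i]]_n) : Prop :=
  exists s : seq R, itv_partition 0 1 s /\
    forall k, (k < size s)%N ->
      exists g : R -> 'M[R[i]]_n, smooth_curve g /\
        forall t, nth 1 (0 :: s) k <= t <= nth 1 (0 :: s) k.+1 -> a t = g t.

(* The integrand is a junk value only at finitely many points. *)
Definition curve_length (R : realType) (n : nat) (a : R -> 'M[R[i]]_n) : R :=
  \int[lebesgue_measure]_(t in `[0, 1]) spectral_norm (curve_derive a t).

Definition joining_curve (R : realType) (n : nat) (U V : 'M[R[i]]_n)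
    (a : R -> 'M[R[i]]_n) : Prop :=
  [/\ piecewise_smooth a, (forall t, 0 <= t <= 1 -> a t \is unitarymx),
      a 0 = U & a 1 = V].

Definition dist_unitary (R : realType) (n : nat) (U V : 'M[R[i]]_n) : R :=
  inf [set curve_length a | a in joining_curve U V].

Definition geodesic_generator (R : realType) (n : nat) (W0 W1 Z : 'M[R[i]]_n) : Prop :=
  [/\ Z \is hermsymmx, spectral_norm Z < pi & expmx ((0 +i* 1) *: Z) = W0^t* *m W1].

Definition geodesic (R : realType) (n : nat) (W0 Z : 'M[R[i]]_n) (s : R) : 'M[R[i]]_n :=
  W0 *m expmx ((0 +i* s) *: Z).

(* A geodesic is required to exist between any two points of the set, so that
   convexity never holds vacuously; all of them must stay in the set. *)
Definition geodesically_convex (R : realType) (n : nat) (M : set 'M[R[i]]_n) : Prop :=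
  forall W0 W1, M W0 -> M W1 ->
    (exists Z, geodesic_generator W0 W1 Z) /\
    (forall Z, geodesic_generator W0 W1 Z ->
       forall s, 0 <= s <= 1 -> M (geodesic W0 Z s)).

Definition intermediate_set (R : realType) (n : nat) (t : R) (U V : 'M[R[i]]_n) :
    set 'M[R[i]]_n :=
  [set W | [/\ W \is unitarymx,
               dist_unitary U W = t * dist_unitary U V &
               dist_unitary W V = (1 - t) * dist_unitary U V]].

(* Main.v *)
(* For unitary U and V, write U^* V = e^(iZ) with the spectrum of Z in [-pi, pi].
   For 0 <= r < pi, the distance from U to V is at most r if and only if
   Re <Ux, Vx> >= cos r for every unit vector x. The curve t |-> U e^(itZ) gives
   one direction; for the other, a curve in the unitary group moves Ux to Vx on
   the unit sphere at a speed bounded by its own. Combined with the triangle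
   inequality for angles on the sphere, this makes M_t(U, V) the intersection of
   the balls of radii t d and (1 - t) d around U and V, where d < pi/2.

   It remains to see that a ball of radius r < pi/2 around U is geodesically
   convex. If M is the midpoint of the geodesic from W0 to W1 = W0 e^(iZ), then
   W0 + W1 = 2 M cos(Z/2) with 0 <= cos(Z/2) <= 1. Let x be a unit eigenvector
   of U^* M with eigenvalue l. Then cos r <= Re l * <cos(Z/2) x, x>, hence
   cos r <= Re l, and M is in the ball. Bisection and continuity give all other
   points of the geodesic. *)
Require Import Defs.
From mathcomp Require Import all_boot all_order all_algebra.
From mathcomp Require Import all_classical all_reals all_analysis.
From mathcomp Require Import measurable_realfun complex ring lra.
Set Implicit Arguments.
Unset Strict Implicit.
Unset Printing Implicit Defensive.
Import Order.TTheory GRing.Theory Num.Theory.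
Import numFieldNormedType.Exports.
Local Open Scope classical_set_scope.
Local Open Scope ring_scope.
Local Open Scope sesquilinear_scope.
Local Open Scope complex_scope.

(** * Real inner product on [C^n], adjoints and unitary matrices *)

Section RealInnerProduct.
Context {R : realType}.
Implicit Types n m : nat.

(** The real part of the Hermitian product, that is, the Euclidean inner product of [C^n] as a real
    space; it measures angles on the unit sphere. *)
Definition rdot n (v w : 'cV[R[i]]_n) : R :=
  \sum_i (complex.Re (v i 0) * complex.Re (w i 0) + complex.Im (v i 0) * complex.Im (w i 0)).

Lemma euclid_normE n (v : 'cV[R[i]]_n) : euclid_norm v = Num.sqrt (rdot v v).
Proof.
congr Num.sqrt; apply: eq_bigr => i _; case: (v i 0) => a b /=.
by rewrite sqr_sqrtr ?addr_ge0 ?sqr_ge0// !expr2.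
Qed.

Lemma rdotC n (v w : 'cV[R[i]]_n) : rdot v w = rdot w v.
Proof. by apply: eq_bigr => i _; congr (_ + _); rewrite mulrC. Qed.

Lemma rdotDr n (u v w : 'cV[R[i]]_n) : rdot u (v + w) = rdot u v + rdot u w.
Proof.
rewrite -big_split; apply: eq_bigr => i _ /=; rewrite mxE.
by case: (u i 0) (v i 0) (w i 0) => [a b] [c d] [e f] /=; ring.
Qed.

Lemma rdotZr n (a : R) (v w : 'cV[R[i]]_n) : rdot v (a%:C *: w) = a * rdot v w.
Proof.
rewrite mulr_sumr; apply: eq_bigr => i _ /=; rewrite mxE.
by case: (v i 0) (w i 0) => [c d] [e f] /=; ring.
Qed.

Lemma rdotDl n (u v w : 'cV[R[i]]_n) : rdot (v + w) u = rdot v u + rdot w u.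
Proof. by rewrite rdotC rdotDr !(rdotC u). Qed.

Lemma rdotZl n (a : R) (v w : 'cV[R[i]]_n) : rdot (a%:C *: v) w = a * rdot v w.
Proof. by rewrite rdotC rdotZr rdotC. Qed.

Lemma rdot_ge0 n (v : 'cV[R[i]]_n) : 0 <= rdot v v.
Proof. by apply: sumr_ge0 => i _; rewrite -!expr2 addr_ge0 ?sqr_ge0. Qed.

Lemma rdot_eq0 n (v : 'cV[R[i]]_n) : rdot v v = 0 -> v = 0.
Proof.
move=> /eqP; rewrite psumr_eq0 => [/allP h|i _]; last first.
  by rewrite -!expr2 addr_ge0 ?sqr_ge0.
apply/colP => i; have := h i (mem_index_enum i); rewrite mxE.
case: (v i 0) => a b /=; rewrite -!expr2 paddr_eq0 ?sqr_ge0// !sqrf_eq0.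
by case/andP => /eqP-> /eqP->.
Qed.

(* [A^t*], typed as a matrix over [R[i]] rather than over the carrier of its
   closed-field structure. *)
Definition adjmx m n (A : 'M[R[i]]_(m, n)) : 'M[R[i]]_(n, m) :=
  \matrix_(i, j) conjc (A j i).

Lemma adjmxE m n (A : 'M[R[i]]_(m, n)) : A^t* = adjmx A.
Proof. by apply/matrixP => i j; rewrite !mxE. Qed.

Lemma adjmxK m n (A : 'M[R[i]]_(m, n)) : adjmx (adjmx A) = A.
Proof. by apply/matrixP => i j; rewrite !mxE conjcK. Qed.

Lemma adjmxM m n p (A : 'M[R[i]]_(m, n)) (B : 'M[R[i]]_(n, p)) :
  adjmx (A *m B) = adjmx B *m adjmx A.
Proof.
apply/matrixP => i j; rewrite !mxE raddf_sum /=; apply: eq_bigr => k _.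
by rewrite !mxE rmorphM mulrC.
Qed.

Lemma adjmx_diag n (d : 'rV[R[i]]_n) :
  adjmx (diag_mx d) = diag_mx (\row_k conjc (d 0 k)).
Proof.
apply/matrixP => i j; rewrite !mxE eq_sym.
by case: eqVneq => [->|_]; rewrite ?mulr1n// !mulr0n raddf0.
Qed.

Lemma rdotE n (v w : 'cV[R[i]]_n) : rdot v w = complex.Re ((adjmx v *m w) 0 0).
Proof.
rewrite mxE raddf_sum; apply: eq_bigr => i _; rewrite !mxE /=.
by case: (v i 0) (w i 0) => [c d] [e f] /=; ring.
Qed.

Lemma rdot_mull m n (A : 'M[R[i]]_(m, n)) v w :
  rdot (A *m v) w = rdot v (adjmx A *m w).
Proof. by rewrite !rdotE adjmxM mulmxA. Qed.

Lemma rdot_mulr m n (A : 'M[R[i]]_(m, n)) v w :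
  rdot v (A *m w) = rdot (adjmx A *m v) w.
Proof. by rewrite rdotC rdot_mull rdotC. Qed.

Lemma unitarymxE n (U : 'M[R[i]]_n) : (U \is unitarymx) <-> U *m adjmx U = 1%:M.
Proof. by rewrite -adjmxE; split=> [/unitarymxP|h]//; apply/unitarymxP. Qed.

Lemma unitarymxKV n (U : 'M[R[i]]_n) : U \is unitarymx -> U *m adjmx U = 1%:M.
Proof. by move/unitarymxE. Qed.

Lemma unitarymxK n (U : 'M[R[i]]_n) : U \is unitarymx -> adjmx U *m U = 1%:M.
Proof. by move/unitarymxKV/mulmx1C. Qed.

Lemma adjmx_unitary n (U : 'M[R[i]]_n) : U \is unitarymx -> adjmx U \is unitarymx.
Proof. by move=> hU; apply/unitarymxE; rewrite adjmxK unitarymxK. Qed.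

Lemma unitarymxM n (U V : 'M[R[i]]_n) :
  U \is unitarymx -> V \is unitarymx -> U *m V \is unitarymx.
Proof.
move=> hU hV; apply/unitarymxE.
by rewrite adjmxM mulmxA -(mulmxA U) unitarymxKV// mulmx1 unitarymxKV.
Qed.

Lemma adjmxM_unitary n (U V : 'M[R[i]]_n) :
  U \is unitarymx -> V \is unitarymx -> adjmx U *m V \is unitarymx.
Proof. by move=> hU; apply: unitarymxM; exact: adjmx_unitary. Qed.

Lemma diag_conjM n (P : 'M[R[i]]_n) (a b : 'rV[R[i]]_n) : P \is unitarymx ->
  (adjmx P *m diag_mx a *m P) *m (adjmx P *m diag_mx b *m P) =
  adjmx P *m diag_mx (\row_k (a 0 k * b 0 k)) *m P.
Proof.
move=> hP; rewrite !mulmxA -(mulmxA _ P) unitarymxKV// mulmx1 -(mulmxA (adjmx P)).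
congr (_ *m _ *m _); apply/matrixP => i j; rewrite mul_diag_mx !mxE.
by case: eqVneq => [->|_]; rewrite ?mulr1n// !mulr0n mulr0.
Qed.

Lemma rdot_unitary n (U : 'M[R[i]]_n) v w : U \is unitarymx ->
  rdot (U *m v) (U *m w) = rdot v w.
Proof. by move=> hU; rewrite rdot_mull mulmxA unitarymxK// mul1mx. Qed.

Lemma rdot0r n (v : 'cV[R[i]]_n) : rdot v 0 = 0.
Proof. by rewrite -[0](scale0r (0 : 'cV[R[i]]_n)) -[0]/(0%:C) rdotZr mul0r. Qed.

(** The squared length of [|w|^2 v - <v, w> w] is nonnegative and equals
    [|w|^2 (|v|^2 |w|^2 - <v, w>^2)]. *)
Lemma rdot_CS n (v w : 'cV[R[i]]_n) : rdot v w ^+ 2 <= rdot v v * rdot w w.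
Proof.
have [w0|w0] := eqVneq (rdot w w) 0.
  by rewrite (rdot_eq0 w0) !rdot0r expr0n mulr0.
have w1 : 0 < rdot w w by rewrite lt0r w0 rdot_ge0.
have := rdot_ge0 ((rdot w w)%:C *: v + (- rdot v w)%:C *: w).
rewrite !(rdotDl, rdotDr, rdotZl, rdotZr) (rdotC w v).
move: (rdot v v) (rdot w w) (rdot v w) w1 => c a b a0.
rewrite -[b ^+ 2 <= _]subr_ge0 -(pmulr_rge0 (c * a - b ^+ 2) a0).
by congr (is_true (0 <= _)); ring.
Qed.

(** Cauchy-Schwarz for the components of [v] and [w] orthogonal to [u]. It serves twice: for the
    triangle inequality of angles, and to bound the rate at which an angle changes along a curve. *)
Lemma sphere_CS n (u v w : 'cV[R[i]]_n) : rdot u u = 1 ->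
  (rdot v w - rdot v u * rdot u w) ^+ 2 <=
  (rdot v v - rdot u v ^+ 2) * (rdot w w - rdot u w ^+ 2).
Proof.
move=> u1.
have := rdot_CS (v + (- rdot u v)%:C *: u) (w + (- rdot u w)%:C *: u).
rewrite !(rdotDl, rdotDr, rdotZl, rdotZr) u1 (rdotC v u) (rdotC w u).
by congr (is_true (_ <= _)); [congr (_ ^+ 2) | congr (_ * _)]; ring.
Qed.

End RealInnerProduct.

Lemma spectral_decomposition (C : numClosedFieldType) n (A : 'M[C]_n) :
  A *m A^t* = A^t* *m A ->
  exists P : 'M[C]_n, exists d : 'rV[C]_n,
    P \is unitarymx /\ A = P^t* *m diag_mx d *m P.
Proof.
move=> /normalmxP/orthomx_spectralP hA.
exists (spectralmx A), (spectral_diag A); split; first exact: spectral_unitarymx.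
by rewrite -invmx_unitary ?spectral_unitarymx.
Qed.

(** * The relation [arc_close]: angles on the sphere and eigenvalues *)

Section Closeness.
Context {R : realType}.
Implicit Types n m : nat.

(* For [U], [V] unitary and [0 <= r <= pi], [arc_close (cos r) U V] says that the
   spectrum of [U^* V] lies on the arc of half-width [r] around [1]. *)
Definition arc_close n (c : R) (U V : 'M[R[i]]_n) :=
  forall x : 'cV[R[i]]_n, c * rdot x x <= rdot (U *m x) (V *m x).

Lemma arc_close_unit n (c : R) (U V : 'M[R[i]]_n) :
  (forall x : 'cV[R[i]]_n, rdot x x = 1 -> c <= rdot (U *m x) (V *m x)) ->
  arc_close c U V.
Proof.
move=> h x; have [x0|x0] := eqVneq (rdot x x) 0.
  by rewrite (rdot_eq0 x0) !mulmx0 !rdot0r mulr0.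
have x1 : 0 < rdot x x by rewrite lt0r x0 rdot_ge0.
pose a := (Num.sqrt (rdot x x))^-1.
have aa : a * a = (rdot x x)^-1 by rewrite -invfM -expr2 sqr_sqrtr ?rdot_ge0.
have := h (a%:C *: x); rewrite -!scalemxAr !(rdotZl, rdotZr) !mulrA aa.
by rewrite mulVf// => /(_ erefl); rewrite mulrC ler_pdivlMr.
Qed.

Lemma arc_closeC n (c : R) (U V : 'M[R[i]]_n) : arc_close c U V -> arc_close c V U.
Proof. by move=> h x; rewrite rdotC. Qed.

Lemma rdot_bound n (u v : 'cV[R[i]]_n) : rdot u u = 1 -> rdot v v = 1 ->
  -1 <= rdot u v <= 1.
Proof.
by move=> u1 v1; have := rdot_CS u v; rewrite u1 v1 mulr1 => h; apply/andP; split; nra.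
Qed.

Lemma ler_cos : {in `[0, pi] &, {mono @cos R : x y /~ y <= x}}.
Proof. by move=> x y x0 y0; rewrite leNgt ltr_cos// -leNgt. Qed.

Lemma acos_le (p a : R) : -1 <= p <= 1 -> 0 <= a <= pi -> cos a <= p -> acos p <= a.
Proof.
move=> p1 a1; rewrite -{1}[p]acosK ?in_itv// => /=.
by rewrite ler_cos// in_itv/= ?acos_ge0 ?acos_lepi.
Qed.

(** For each unit vector [x], this is the triangle inequality for the angles between [Ux], [Wx] and
    [Vx] on the sphere. *)
Lemma arc_close_trans n (a b : R) (U V W : 'M[R[i]]_n) :
  U \is unitarymx -> V \is unitarymx -> W \is unitarymx ->
  0 <= a -> 0 <= b -> a + b <= pi ->
  arc_close (cos a) U W -> arc_close (cos b) W V -> arc_close (cos (a + b)) U V.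
Proof.
move=> hU hV hW a0 b0 ab hUW hWV; apply: arc_close_unit => x x1.
have := hUW x; have := hWV x; rewrite x1 !mulr1.
have := sphere_CS (U *m x) (V *m x) (etrans (rdot_unitary x x hW) x1).
have pb := rdot_bound (etrans (rdot_unitary x x hU) x1) (etrans (rdot_unitary x x hW) x1).
have qb := rdot_bound (etrans (rdot_unitary x x hW) x1) (etrans (rdot_unitary x x hV) x1).
rewrite !rdot_unitary// x1 (rdotC (W *m x) (U *m x)).
move: (rdot (U *m x) (V *m x)) (rdot (U *m x) (W *m x)) (rdot (W *m x) (V *m x)) pb qb.
move=> s p q pb qb hs qh ph.
have a1 : 0 <= a <= pi by rewrite a0 (le_trans _ ab) ?lerDl.
have b1 : 0 <= b <= pi by rewrite b0 (le_trans _ ab) ?lerDr.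
have al := acos_le pb a1 ph; have bl := acos_le qb b1 qh.
(* Since [acos p <= a], [acos q <= b] and the cosine decreases up to [a + b <= pi], it suffices to
   bound [s] below by this larger value. *)
apply: (@le_trans _ _ (cos (acos p + acos q))).
  rewrite ler_cos ?lerD// in_itv/= ?addr_ge0 ?acos_ge0//=.
  by rewrite (le_trans _ ab) ?lerD.
rewrite cosD !acosK ?in_itv//; move: hs.
rewrite -{1}[p]acosK ?in_itv// -{2}[p]acosK ?in_itv//.
rewrite -{1}[q]acosK ?in_itv// -{2}[q]acosK ?in_itv//.
(* Now [sphere_CS] bounds [|s - p q|] by the product of the two sines; the lower half of this bound
   is the addition formula for the cosine. *)
rewrite -!sin2cos2 -exprMn -[in X in X -> _]ler_sqrt ?sqr_ge0// !sqrtr_sqr.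
rewrite [X in _ <= X]ger0_norm ?mulr_ge0 ?sin_ge0_pi ?acos_ge0 ?acos_lepi//.
by rewrite ler_norml !acosK ?in_itv// => /andP[+ _]; lra.
Qed.

Lemma arc_closeE n (c : R) (U V : 'M[R[i]]_n) :
  arc_close c U V <-> forall x, c * rdot x x <= rdot x (adjmx U *m V *m x).
Proof. by split => h x; move: (h x); rewrite -mulmxA rdot_mull. Qed.

Definition cis (t : R) : R[i] := cos t +i* sin t.

(** The matrix [e^(itZ)] for the Hermitian [Z] with eigenvalues [z] in the orthonormal basis given
    by [P], written without the series. [expmx_diag] links it to [expmx]. *)
Definition unitary_exp n (P : 'M[R[i]]_n) (z : 'I_n -> R) (t : R) : 'M[R[i]]_n :=
  adjmx P *m diag_mx (\row_k cis (t * z k)) *m P.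

Lemma normal_diag n (A : 'M[R[i]]_n) : A *m adjmx A = adjmx A *m A ->
  exists P : 'M[R[i]]_n, exists d : 'rV[R[i]]_n, P \is unitarymx /\
   A = adjmx P *m diag_mx d *m P.
Proof.
rewrite -adjmxE => /spectral_decomposition[P [d [hP hd]]].
by exists P, d; rewrite -adjmxE.
Qed.

Lemma unitary_diag n (A : 'M[R[i]]_n) : A \is unitarymx ->
  exists P : 'M[R[i]]_n, exists d : 'rV[R[i]]_n, [/\ P \is unitarymx,
   A = adjmx P *m diag_mx d *m P &
   forall k, complex.Re (d 0 k) ^+ 2 + complex.Im (d 0 k) ^+ 2 = 1].
Proof.
move=> hA; have [|P [d [hP hd]]] := @normal_diag n A.
  by rewrite unitarymxK// unitarymxKV.
exists P, d; split=> // k.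
have e : diag_mx d = P *m A *m adjmx P.
  by rewrite hd !mulmxA unitarymxKV// mul1mx -mulmxA unitarymxKV// mulmx1.
have : diag_mx d \is unitarymx.
  by rewrite e; apply: unitarymxM (adjmx_unitary hP); exact: unitarymxM.
move/unitarymxKV => /matrixP/(_ k k); rewrite adjmx_diag mul_diag_mx !mxE !eqxx !mulr1n.
by case: (d 0 k) => a b /= [h _]; rewrite -h; ring.
Qed.

Lemma rdot_diag n (P : 'M[R[i]]_n) (d : 'rV[R[i]]_n) x :
  rdot x (adjmx P *m diag_mx d *m P *m x) =
  \sum_k complex.Re (d 0 k) * (complex.Re ((P *m x) k 0) ^+ 2 + complex.Im ((P *m x) k 0) ^+ 2).
Proof.
rewrite -!mulmxA rdot_mulr adjmxK; move: (P *m x) => y.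
by apply: eq_bigr => k _; rewrite mul_diag_mx mxE; case: (d 0 k) (y k 0) => [a b] [e f] /=; ring.
Qed.

Lemma rdot_delta n (k : 'I_n) : rdot (delta_mx k 0) (delta_mx k 0 : 'cV[R[i]]_n) = 1.
Proof.
rewrite /rdot (bigD1 k)//= big1 ?addr0 => [|i ik]; rewrite mxE ?(negPf ik) /=.
  by rewrite !eqxx /= mulr0 mulr1 addr0.
by rewrite !mulr0 addr0.
Qed.


(** In the eigenbasis, [Re <x, U^* V x>] is the sum of the [Re (d 0 k)] with weights [|(Px)_k|^2] of
    total [|x|^2]. Conversely, the vectors [P^* e_k] isolate single eigenvalues. *)
Lemma arc_close_eigen n (c : R) (U V P : 'M[R[i]]_n) (d : 'rV[R[i]]_n) :
  P \is unitarymx -> adjmx U *m V = adjmx P *m diag_mx d *m P ->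
  arc_close c U V <-> forall k, c <= complex.Re (d 0 k).
Proof.
move=> hP e; rewrite arc_closeE e; split=> h.
  move=> k; have := h (adjmx P *m delta_mx k 0).
  rewrite rdot_diag mulmxA unitarymxKV// mul1mx rdot_mull adjmxK mulmxA.
  rewrite unitarymxKV// mul1mx rdot_delta mulr1 (bigD1 k)//= big1 => [|i ik].
    by rewrite mxE !eqxx /= expr1n expr0n /= !addr0 mulr1.
  by rewrite mxE (negPf ik) /= expr0n /= addr0 mulr0.
move=> x; rewrite rdot_diag -(rdot_unitary x x hP) mulr_sumr.
by apply: ler_sum => k _; rewrite -!expr2 ler_wpM2r ?addr_ge0 ?sqr_ge0.
Qed.

Lemma angle_exists (a b r : R) : 0 <= r <= pi -> a ^+ 2 + b ^+ 2 = 1 -> cos r <= a ->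
  exists2 t, `|t| <= r & a +i* b = cis t.
Proof.
move=> r0 ab ra; have a1 : -1 <= a <= 1 by apply/andP; split; nra.
have bE : sin (acos a) = `|b|.
  by rewrite sin_acos// -ab addrC addKr sqrtr_sqr.
have ar := acos_le a1 r0 ra; rewrite /cis; have [b0|b0] := leP 0 b.
  exists (acos a); rewrite ?ger0_norm ?acos_ge0//.
  by rewrite acosK ?in_itv// bE ger0_norm.
exists (- acos a); rewrite ?normrN ?ger0_norm ?acos_ge0//.
by rewrite cosN sinN acosK ?in_itv// bE ltr0_norm// opprK.
Qed.

(** A logarithm of [U^* V] is built one eigenvalue at a time, each angle being plus or minus an arc
    cosine. It yields both a short curve from [U] to [V] and a generator of a geodesic. *)
Lemma unitary_exp_exists n (r : R) (U V : 'M[R[i]]_n) : 0 <= r <= pi ->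
  U \is unitarymx -> V \is unitarymx -> arc_close (cos r) U V ->
  exists P : 'M[R[i]]_n, exists z : 'I_n -> R, [/\ P \is unitarymx,
    forall k, `|z k| <= r & adjmx U *m V = unitary_exp P z 1].
Proof.
move=> r0 hU hV hc.
have [P [d [hP e d1]]] := unitary_diag (adjmxM_unitary hU hV).
have h k := angle_exists r0 (d1 k) ((arc_close_eigen (cos r) hP e).1 hc k).
have {}h k : exists t, `|t| <= r /\ d 0 k = cis t.
  by have [t tr te] := h k; exists t; split=> //; rewrite -te; case: (d 0 k).
have [z hz] := choice h.
exists P, z; split; [exact: hP|by move=> k; case: (hz k)|rewrite e /unitary_exp].
have -> // : d = \row_k cis (1 * z k).
by apply/rowP => k; rewrite mxE mul1r; case: (hz k).
Qed.

(** Since [cos pi = -1], this is only Cauchy-Schwarz. Its use: any two unitary matrices are joined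
    by a curve, so the infimum in [dist_unitary] runs over a nonempty set. *)
Lemma arc_close_piN n (U V : 'M[R[i]]_n) :
  U \is unitarymx -> V \is unitarymx -> arc_close (cos pi) U V.
Proof.
move=> hU hV; apply: arc_close_unit => x x1; rewrite cospi.
have /andP[//] : -1 <= rdot (U *m x) (V *m x) <= 1.
by apply: rdot_bound; rewrite rdot_unitary.
Qed.

Lemma cisD (s t : R) : cis (s + t) = cis s * cis t.
Proof. by rewrite /cis cosD sinD; congr (_ +i* _); ring. Qed.

Lemma cis0 : cis 0 = 1 :> R[i]. Proof. by rewrite /cis cos0 sin0. Qed.

Lemma unitary_expD n (P : 'M[R[i]]_n) z (s t : R) : P \is unitarymx ->
  unitary_exp P z (s + t) = unitary_exp P z s *m unitary_exp P z t.
Proof.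
move=> hP; rewrite /unitary_exp diag_conjM//; congr (_ *m diag_mx _ *m _).
by apply/rowP => k; rewrite !mxE mulrDl cisD.
Qed.

Lemma unitary_exp0 n (P : 'M[R[i]]_n) z : P \is unitarymx ->
  unitary_exp P z 0 = 1%:M.
Proof.
move=> hP; rewrite /unitary_exp -[RHS](unitarymxK hP); congr (_ *m _).
rewrite -[RHS]mulmx1; congr (_ *m _); rewrite -diag_const_mx; congr diag_mx.
by apply/rowP => k; rewrite !mxE mul0r cis0.
Qed.

Lemma adjmx_unitary_exp n (P : 'M[R[i]]_n) z t :
  adjmx (unitary_exp P z t) = unitary_exp P z (- t).
Proof.
rewrite !adjmxM adjmxK mulmxA adjmx_diag; congr (_ *m diag_mx _ *m _).
by apply/rowP => k; rewrite !mxE /cis mulNr cosN sinN.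
Qed.

Lemma unitary_exp_unitary n (P : 'M[R[i]]_n) z t : P \is unitarymx ->
  unitary_exp P z t \is unitarymx.
Proof.
move=> hP; apply/unitarymxE.
by rewrite adjmx_unitary_exp -unitary_expD// addrN unitary_exp0.
Qed.

End Closeness.

(** * Convexity of balls along geodesics *)

Section Geodesics.
Context {R : realType}.
Implicit Types n m : nat.

Lemma rdot_conjZ_diag n (l : R[i]) (d : 'I_n -> R) (y : 'cV[R[i]]_n) :
  rdot (l^* *: y) (diag_mx (\row_k (d k)%:C) *m y) =
  complex.Re l * \sum_k d k * (complex.Re (y k 0) ^+ 2 + complex.Im (y k 0) ^+ 2).
Proof.
rewrite mulr_sumr; apply: eq_bigr => k _; rewrite mul_diag_mx !mxE.
by case: l (y k 0) => [a b] [e f] /=; ring.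
Qed.

(* [W (e^{-ihZ} + e^{ihZ}) = 2 W cos(hZ)] with [0 <= cos(hZ) <= 1]. Pairing both
   sides with an eigenvector of the unitary [U^* W], for the eigenvalue [l],
   turns the hypotheses into [c <= Re l * q] with [0 <= q <= 1]. *)
Lemma arc_close_midpoint n (c h : R) (U W P : 'M[R[i]]_n) (z : 'I_n -> R) :
  U \is unitarymx -> W \is unitarymx -> P \is unitarymx -> 0 < c ->
  (forall k, 0 <= cos (h * z k)) ->
  arc_close c U (W *m unitary_exp P z (- h)) ->
  arc_close c U (W *m unitary_exp P z h) -> arc_close c U W.
Proof.
move=> hU hW hP c0 hz h1 h2.
have [Q [d [hQ e d1]]] := unitary_diag (adjmxM_unitary hU hW).
apply/(arc_close_eigen c hQ e) => k.
pose x := adjmx Q *m (delta_mx k 0 : 'cV[R[i]]_n).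
have x1 : rdot x x = 1 by rewrite (rdot_unitary _ _ (adjmx_unitary hQ)) rdot_delta.
have ex : adjmx W *m (U *m x) = (d 0 k)^* *: x.
  rewrite /x mulmxA -[adjmx W *m U](adjmxK (adjmx W *m U)) adjmxM adjmxK e !adjmxM adjmxK.
  rewrite -!mulmxA (mulmxA Q) unitarymxKV// mul1mx.
  rewrite scalemxAr; congr (_ *m _).
  rewrite adjmx_diag mul_diag_mx; apply/colP => j.
  by rewrite !mxE; case: eqVneq => [->|]; rewrite ?mulr0.
have e2 : unitary_exp P z (- h) + unitary_exp P z h =
    adjmx P *m diag_mx (\row_k (2 * cos (h * z k))%:C) *m P.
  rewrite /unitary_exp -mulmxDl -mulmxDr -(raddfD (@diag_mx _ n)).
  congr (_ *m diag_mx _ *m _); apply/rowP => j; rewrite !mxE /cis mulNr cosN sinN.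
  by apply/eqP; rewrite eq_complex /= addNr eqxx andbT; apply/eqP; ring.
have := lerD (h1 x) (h2 x); rewrite x1 mulr1 -rdotDr -mulmxDl -mulmxDr e2.
rewrite -mulmxA rdot_mulr ex -2!mulmxA rdot_mulr adjmxK -scalemxAr.
rewrite -?(mulmxA (diag_mx _)) (rdot_conjZ_diag _ (fun j => 2 * cos (h * z j))) /=.
set y := P *m x; have y1 : rdot y y = 1 by rewrite rdot_unitary.
under eq_bigr do rewrite -mulrA.
rewrite -mulr_sumr; set q := \sum_k _.
have q0 : 0 <= q by apply: sumr_ge0 => j _; rewrite mulr_ge0 ?addr_ge0 ?sqr_ge0.
have q1 : q <= 1.
  rewrite -y1; apply: ler_sum => j _; rewrite -!expr2 ler_piMl ?addr_ge0 ?sqr_ge0//.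
move: q q0 q1 (complex.Re (d 0 k)) => {y y1} q q0 q1 l hl.
(* The hypothesis now reads [c <= l * q]. As [c > 0] and [q >= 0], it excludes [l <= 0]; for
   [l >= 0], [q <= 1] gives [c <= l]. *)
have [l0|/ltW l0] := leP l 0; first by have := mulr_ge0_le0 q0 l0; lra.
by have := ler_wpM2l l0 q1; lra.
Qed.

(** The real and imaginary parts of the entries of [W e^(isZ)], and its pairings with fixed vectors,
    have this form. The family is closed under differentiation, which gives continuity and
    smoothness. *)
Definition trigsum n (z a b : 'I_n -> R) (s : R) : R :=
  \sum_k (a k * cos (s * z k) + b k * sin (s * z k)).

Lemma is_derive_trigsum n (z a b : 'I_n -> R) (s : R) :
  is_derive s 1 (trigsum z a b)
    (trigsum z (fun k => b k * z k) (fun k => - (a k * z k)) s).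
Proof.
have -> : trigsum z a b =
    \sum_(k < n) (fun s : R => a k * cos (s * z k) + b k * sin (s * z k)).
  by apply/funext => u; rewrite fct_sumE.
apply: is_derive_sum => k.
apply: is_derive_eq.
by rewrite /GRing.scale /=; ring.
Qed.

Lemma continuous_trigsum n (z a b : 'I_n -> R) : continuous (trigsum z a b).
Proof.
move=> s; apply: differentiable_continuous; apply/derivable1_diffP.
by case: (is_derive_trigsum z a b s).
Qed.

Lemma continuous_rdot_unitary_exp n (P W : 'M[R[i]]_n) z u v :
  continuous (fun s : R => rdot u (W *m unitary_exp P z s *m v)).
Proof.
pose a := P *m adjmx W *m u; pose b := P *m v.
have -> : (fun s : R => rdot u (W *m unitary_exp P z s *m v)) = trigsum z
  (fun k => complex.Re (a k 0) * complex.Re (b k 0) + complex.Im (a k 0) * complex.Im (b k 0))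
  (fun k => complex.Im (a k 0) * complex.Re (b k 0) - complex.Re (a k 0) * complex.Im (b k 0)).
  apply/funext => s; rewrite -!mulmxA rdot_mulr rdot_mulr adjmxK mulmxA.
  rewrite -/a -/b; move: a b => a b; apply: eq_bigr => k _.
  by rewrite mul_diag_mx !mxE; case: (a k 0) (b k 0) => [c d] [e f] /=; ring.
exact: continuous_trigsum.
Qed.

(** If [f s < d], this would persist on a neighbourhood of [s], which contains one of the points
    [a]. It concludes the bisection and also the removal of the slack in [dist_unitary_close]. *)
Lemma ge_limit_dyadic (f : R -> R) (d s : R) : {for s, continuous f} ->
  (forall m, exists a, `|s - a| <= 2^-1 ^+ m /\ d <= f a) -> d <= f s.
Proof.
move=> /cvgrPdist_lt cf h; rewrite leNgt; apply/negP => hx.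
have /cf /nbhs_ballP[e /= e0 he] : 0 < d - f s by rewrite subr_gt0.
have [m hm] : exists m, 2^-1 ^+ m < e.
  have := @cvg_expr R 2^-1; rewrite ger0_norm ?invr_ge0// invf_lt1 ?ltr1n// => /(_ isT).
  move=> /cvgrPdist_lt/(_ _ e0)[m _ /(_ m (leqnn m))].
  by rewrite /= sub0r normrN ger0_norm ?exprn_ge0 ?invr_ge0// => ?; exists m.
have [a [sa da]] := h m.
have := he a (le_lt_trans sa hm); rewrite ltr_norml => /andP[+ _]; lra.
Qed.

Lemma arc_close_geodesic n (c : R) (U W P : 'M[R[i]]_n) (z : 'I_n -> R) (s : R) :
  U \is unitarymx -> W \is unitarymx -> P \is unitarymx -> 0 < c ->
  (forall k, `|z k| < pi) ->
  arc_close c U W -> arc_close c U (W *m unitary_exp P z 1) -> 0 <= s <= 1 ->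
  arc_close c U (W *m unitary_exp P z s).
Proof.
move=> hU hW hP c0 hz h0 h1 /andP[s0 s1].
(* Bisection around [s]: both endpoints of the current interval stay in the ball, and
   [arc_close_midpoint] adds its midpoint. *)
have bis m : exists a b, [/\ a <= s <= b, b - a <= 2^-1 ^+ m,
    arc_close c U (W *m unitary_exp P z a) & arc_close c U (W *m unitary_exp P z b)].
  elim: m => [|m [a [b [/andP[as_ sb] ba ha hb]]]].
    exists 0, 1; split.
    - by rewrite s0.
    - by rewrite subr0 expr0.
    - by rewrite (unitary_exp0 z hP) mulmx1; exact: h0.
    - exact: h1.
  have e : 2^-1 ^+ m.+1 = 2^-1 ^+ m / 2 :> R by rewrite exprSr.
  have : 2^-1 ^+ m <= 1 :> R by rewrite exprn_ile1 ?invr_ge0 ?invf_le1 ?ler1n.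
  move: (2^-1 ^+ m) (2^-1 ^+ m.+1) e ba => d _ -> ba d1.
  have hm : arc_close c U (W *m unitary_exp P z ((a + b) / 2)).
    apply: (@arc_close_midpoint _ _ ((b - a) / 2) _ _ P z hU _ hP c0).
    - by apply: unitarymxM hW _; exact: unitary_exp_unitary.
    (* The half-length is at most [1 / 2] and [|z k| < pi], so the angle stays below [pi / 2]. *)
    - move=> k; rewrite -cos_norm cos_ge0_pihalf// normrM.
      have hh : 0 <= (b - a) / 2 by rewrite divr_ge0// subr_ge0 (le_trans as_).
      have h1' : (b - a) / 2 <= 1 / 2 by rewrite ler_pM2r ?invr_gt0// (le_trans ba).
      rewrite (ger0_norm hh); have := ler_wpM2r (normr_ge0 (z k)) h1'.
      by have := mulr_ge0 hh (normr_ge0 (z k)); have := hz k; lra.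
    - rewrite -mulmxA -(unitary_expD _ _ _ hP).
      have -> : (a + b) / 2 + - ((b - a) / 2) = a by field.
      exact: ha.
    - rewrite -mulmxA -(unitary_expD _ _ _ hP).
      have -> : (a + b) / 2 + ((b - a) / 2) = b by field.
      exact: hb.
  have [ms|ms] := leP s ((a + b) / 2).
    exists a, ((a + b) / 2); split; [by rewrite as_|lra|exact: ha|exact: hm].
  exists ((a + b) / 2), b; split; [by rewrite sb ltW|lra|exact: hm|exact: hb].
move=> x; apply: (@ge_limit_dyadic (fun t => rdot (U *m x) (W *m unitary_exp P z t *m x))).
  exact: continuous_rdot_unitary_exp.
move=> m; have [a [b [/andP[as_ sb] ba ha _]]] := bis m; exists a; split; last exact: ha.
by rewrite ger0_norm ?subr_ge0// (le_trans _ ba)// lerB.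
Qed.

End Geodesics.

(** * The exponential series of [i] times a Hermitian matrix *)

Section Exponential.
Context {R : realType}.
Implicit Types n m : nat.

Lemma mx_diag_entry m n p (A : 'M[R[i]]_(m, n)) (d : 'rV[R[i]]_n) (B : 'M[R[i]]_(n, p)) i j :
  (A *m diag_mx d *m B) i j = \sum_k A i k * B k j * d 0 k.
Proof.
rewrite -mulmxA mul_diag_mx mxE; apply: eq_bigr => k _.
by rewrite !mxE mulrCA mulrC.
Qed.

Lemma diag_conjX n (P : 'M[R[i]]_n) (d : 'rV[R[i]]_n) l : P \is unitarymx ->
  (adjmx P *m diag_mx d *m P) ^+ l = adjmx P *m diag_mx (\row_k d 0 k ^+ l) *m P.
Proof.
move=> hP; elim: l => [|l IH].
  rewrite expr0 -[LHS](unitarymxK hP); congr (_ *m _).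
  rewrite -[LHS]mulmx1; congr (_ *m _); rewrite -diag_const_mx; congr diag_mx.
  by apply/rowP => k; rewrite !mxE expr0.
rewrite exprS IH; apply: etrans (diag_conjM _ _ hP) _.
by congr (_ *m diag_mx _ *m _); apply/rowP => k; rewrite !mxE exprS.
Qed.

(** Even powers of [i t] are real and odd ones imaginary, while [sin_coeff] vanishes at even indices
    and [cos_coeff] at odd ones. *)
Lemma imaginary_exp_coeff (t : R) l :
  (l`!%:R^-1 : R[i]) * (0 +i* t) ^+ l = cos_coeff t l +i* sin_coeff t l.
Proof.
have e m : ((0 +i* t) ^+ m.*2 = ((-1) ^+ m * t ^+ m.*2)%:C)%R.
  rewrite -muln2 mulnC !exprM -exprMn rmorphXn; congr (_ ^+ _).
  by apply/eqP; rewrite eq_complex /= !expr2; apply/andP; split; apply/eqP; ring.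
have -> : (l`!%:R^-1 : R[i]) = (l`!%:R^-1)%:C by rewrite fmorphV rmorph_nat.
rewrite /cos_coeff /sin_coeff /= -(odd_double_half l); case: (odd l) => /=.
  rewrite add0n uphalf_double doubleK odd_double /= exprS e !exprS -exprnP.
  apply/eqP; rewrite eq_complex /=; apply/andP; split; apply/eqP; ring.
rewrite add0n doubleK odd_double /= e -exprnP.
by apply/eqP; rewrite eq_complex /=; apply/andP; split; apply/eqP; ring.
Qed.

Lemma cvg_sumr (I : finType) (f : I -> nat -> R) (a : I -> R) :
  (forall i, f i @ \oo --> a i) -> (fun k => \sum_i f i k) @ \oo --> \sum_i a i.
Proof.
by move=> h; apply: cvg_big => //; exact: add_continuous.
Qed.

(** Each entry of a partial sum is a combination, with weights [w k] independent of the order, of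
    partial sums of the cosine and sine series at [s * z k]. Real and imaginary parts thus converge
    separately. *)
Lemma expmx_diag n (P : 'M[R[i]]_n) (z : 'I_n -> R) (s : R) : P \is unitarymx ->
  expmx ((0 +i* s) *: (adjmx P *m diag_mx (\row_k (z k)%:C) *m P)) =
  unitary_exp P z s.
Proof.
move=> hP; have -> : (0 +i* s) *: (adjmx P *m diag_mx (\row_k (z k)%:C) *m P) =
    adjmx P *m diag_mx (\row_k (0 +i* (s * z k))) *m P.
  rewrite scalemxAl scalemxAr; congr (_ *m _ *m _).
  apply/matrixP => i j; rewrite !mxE; case: eqVneq => [->|_]; rewrite ?mulr0// !mulr1n.
  by apply/eqP; rewrite eq_complex /=; apply/andP; split; apply/eqP; ring.
apply/matrixP => i j; rewrite [LHS]mxE /unitary_exp mx_diag_entry.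
pose w k := adjmx P i k * P k j.
have e N : (\sum_(0 <= l < N) (l`!%:R^-1 : R[i]) *:
    (adjmx P *m diag_mx (\row_k (0 +i* (s * z k))) *m P) ^+ l) i j =
    \sum_k w k * (series (cos_coeff (s * z k)) N +i* series (sin_coeff (s * z k)) N).
  rewrite summxE.
  under eq_bigr => l _ do rewrite mxE diag_conjX// mx_diag_entry mulr_sumr.
  rewrite exchange_big; apply: eq_bigr => k _.
  have -> : series (cos_coeff (s * z k)) N +i* series (sin_coeff (s * z k)) N =
      \sum_(0 <= l < N) (cos_coeff (s * z k) l +i* sin_coeff (s * z k) l).
    by apply/eqP; rewrite eq_complex !raddf_sum !eqxx.
  rewrite mulr_sumr; apply: eq_bigr => l _.
  by rewrite -imaginary_exp_coeff 2![(\row_k0 _) _ _]mxE [LHS]mulrCA.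
have cc k : series (cos_coeff (s * z k)) @ \oo --> cos (s * z k).
  by rewrite unlock; exact: is_cvg_series_cos_coeff.
have cs k : series (sin_coeff (s * z k)) @ \oo --> sin (s * z k).
  by rewrite unlock; exact: is_cvg_series_sin_coeff.
apply/eqP; rewrite eq_complex /= !raddf_sum; apply/andP; split; apply/eqP.
  apply: cvg_lim => //.
  under eq_fun do rewrite e raddf_sum.
  apply: cvg_sumr => k; rewrite mxE -/(w k) /cis; case: (w k) => a b /=.
  by apply: cvgB; (apply: cvgM; [exact: cvg_cst|]).
apply: cvg_lim => //.
under eq_fun do rewrite e raddf_sum.
apply: cvg_sumr => k; rewrite mxE -/(w k) /cis; case: (w k) => a b /=.
by apply: cvgD; (apply: cvgM; [exact: cvg_cst|]).
Qed.

End Exponential.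

(** * Finiteness and continuity of the spectral norm *)

Section SpectralNorm.
Context {R : realType}.
Implicit Types n m : nat.

Lemma le_sqrt_rdot n m (v : 'cV[R[i]]_n) (w : 'cV[R[i]]_m) (c : R) : 0 <= c ->
  rdot v v <= c ^+ 2 * rdot w w -> euclid_norm v <= c * euclid_norm w.
Proof.
move=> c0 h; rewrite !euclid_normE -{1}(ger0_norm c0) -sqrtr_sqr.
by rewrite -sqrtrM ?sqr_ge0// ler_sqrt// mulr_ge0 ?sqr_ge0 ?rdot_ge0.
Qed.

Lemma euclid_normD n (v w : 'cV[R[i]]_n) :
  euclid_norm (v + w) <= euclid_norm v + euclid_norm w.
Proof.
rewrite -(ler_pXn2r (n := 2)) ?nnegrE ?addr_ge0 ?sqrtr_ge0//.
rewrite !euclid_normE sqrrD !sqr_sqrtr ?rdot_ge0// !(rdotDl, rdotDr) (rdotC w v).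
have : rdot v w <= Num.sqrt (rdot v v) * Num.sqrt (rdot w w).
  apply: le_trans (ler_norm _) _; rewrite -sqrtrM ?rdot_ge0// -sqrtr_sqr.
  by rewrite ler_sqrt ?mulr_ge0 ?rdot_ge0// rdot_CS.
by lra.
Qed.

(** The squared Frobenius norm. It bounds the set whose supremum is [spectral_norm] and controls
    differences of spectral norms. *)
Definition normsq m n (A : 'M[R[i]]_(m, n)) : R :=
  \sum_i \sum_j (complex.Re (A i j) ^+ 2 + complex.Im (A i j) ^+ 2).

Lemma normsq_ge0 m n (A : 'M[R[i]]_(m, n)) : 0 <= normsq A.
Proof. by apply: sumr_ge0 => i _; apply: sumr_ge0 => j _; rewrite addr_ge0 ?sqr_ge0. Qed.

Lemma euclid_norm_mulmx m n (A : 'M[R[i]]_(m, n)) v :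
  euclid_norm (A *m v) <= Num.sqrt (2 * normsq A) * euclid_norm v.
Proof.
apply: le_sqrt_rdot; rewrite ?sqrtr_ge0// sqr_sqrtr ?mulr_ge0 ?normsq_ge0//.
rewrite /normsq [2 * _]mulr_sumr mulr_suml; apply: ler_sum => i _.
(* Real pairing with [p] gives the real part of the entry [i] of [A v]; pairing with [q], which is
   [i] times [p], gives the imaginary part. The two Cauchy-Schwarz bounds add up to the factor 2. *)
pose p := \col_j conjc (A i j); pose q := \col_j (complex.Im (A i j) +i* complex.Re (A i j)).
have ep : complex.Re ((A *m v) i 0) = rdot p v.
  rewrite mxE raddf_sum; apply: eq_bigr => j _; rewrite !mxE.
  by case: (A i j) (v j 0) => [a b] [c d] /=; ring.
have eq : complex.Im ((A *m v) i 0) = rdot q v.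
  rewrite mxE raddf_sum; apply: eq_bigr => j _; rewrite !mxE.
  by case: (A i j) (v j 0) => [a b] [c d] /=; ring.
have np : rdot p p = \sum_j (complex.Re (A i j) ^+ 2 + complex.Im (A i j) ^+ 2).
  by apply: eq_bigr => j _; rewrite !mxE; case: (A i j) => [a b] /=; ring.
have nq : rdot q q = \sum_j (complex.Re (A i j) ^+ 2 + complex.Im (A i j) ^+ 2).
  by apply: eq_bigr => j _; rewrite !mxE; case: (A i j) => [a b] /=; ring.
rewrite ep eq; have := rdot_CS p v; have := rdot_CS q v; rewrite np nq; lra.
Qed.

Lemma le_spectral_norm n (A : 'M[R[i]]_n) v :
  euclid_norm v <= 1 -> euclid_norm (A *m v) <= spectral_norm A.
Proof.
move=> v1; apply: ub_le_sup; last by exists v.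
exists (Num.sqrt (2 * normsq A)) => _ [w w1 <-].
by apply: le_trans (euclid_norm_mulmx _ _) _; rewrite ler_piMr ?sqrtr_ge0.
Qed.

Lemma euclid_norm0 n : euclid_norm (0 : 'cV[R[i]]_n) = 0.
Proof. by rewrite euclid_normE rdot0r sqrtr0. Qed.

Lemma spectral_norm_le n (A : 'M[R[i]]_n) (c : R) : 
  (forall v, euclid_norm v <= 1 -> euclid_norm (A *m v) <= c) -> spectral_norm A <= c.
Proof.
move=> h; apply: ge_sup.
  by exists (euclid_norm (A *m 0)), 0 => //=; rewrite euclid_norm0.
by move=> _ [v v1 <-]; exact: h.
Qed.

Lemma spectral_norm_ge0 n (A : 'M[R[i]]_n) : 0 <= spectral_norm A.
Proof.
have := @le_spectral_norm n A 0; rewrite mulmx0 euclid_norm0; exact.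
Qed.

Lemma spectral_normB n (A B : 'M[R[i]]_n) :
  spectral_norm A <= spectral_norm B + Num.sqrt (2 * normsq (A - B)).
Proof.
apply: spectral_norm_le => v v1.
have -> : A *m v = B *m v + (A - B) *m v by rewrite -mulmxDl addrC subrK.
apply: le_trans (euclid_normD _ _) _; apply: lerD; first exact: le_spectral_norm.
by apply: le_trans (euclid_norm_mulmx _ _) _; rewrite ler_piMr ?sqrtr_ge0.
Qed.

Lemma normsqN n (A B : 'M[R[i]]_n) : normsq (A - B) = normsq (B - A).
Proof.
apply: eq_bigr => i _; apply: eq_bigr => j _; rewrite !mxE.
by case: (A i j) (B i j) => [a b] [c d] /=; ring.
Qed.

(** By [spectral_normB] in both directions, the norms at [t] and [s] differ by at most [D t], which
    is continuous at [s] and vanishes there. *)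
Lemma continuous_spectral_norm n (g : R -> 'M[R[i]]_n) :
  (forall i j, continuous (fun t => complex.Re (g t i j)) /\
               continuous (fun t => complex.Im (g t i j))) ->
  continuous (fun t => spectral_norm (g t)).
Proof.
move=> cg s; pose D t := Num.sqrt (2 * normsq (g t - g s)).
have cD : D @ s --> D s.
  apply: (@continuous_comp _ _ _ (fun t => 2 * normsq (g t - g s)) Num.sqrt); last first.
    exact: sqrt_continuous.
  apply: cvgM; first exact: cvg_cst.
  apply: cvg_big => [|i _]; first exact: add_continuous.
  apply: cvg_big => [|j _]; first exact: add_continuous.
  have [cR cI] := cg i j.
  have e t : complex.Re ((g t - g s) i j) ^+ 2 + complex.Im ((g t - g s) i j) ^+ 2 =
     (complex.Re (g t i j) - complex.Re (g s i j)) * (complex.Re (g t i j) - complex.Re (g s i j)) +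
     (complex.Im (g t i j) - complex.Im (g s i j)) * (complex.Im (g t i j) - complex.Im (g s i j)).
    by rewrite !mxE -!expr2; case: (g t i j) (g s i j) => [a b] [c d].
  rewrite e; under eq_fun do rewrite e.
  by apply: cvgD; apply: cvgM; apply: cvgB; (exact: cvg_cst || exact: cR || exact: cI).
have D0 : D s = 0.
  rewrite /D subrr /normsq big1 ?mulr0 ?sqrtr0// => i _.
  by rewrite big1// => j _; rewrite mxE /= expr0n addr0.
apply/cvgrPdist_lt => e e0; move/cvgrPdist_lt/(_ e e0): cD.
apply: filterS => t; rewrite D0 sub0r normrN ger0_norm ?sqrtr_ge0// => De.
have h1 : spectral_norm (g t) <= spectral_norm (g s) + D t := spectral_normB _ _.
have h2 : spectral_norm (g s) <= spectral_norm (g t) + D t.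
  by rewrite /D normsqN; exact: spectral_normB.
move: (spectral_norm _) (spectral_norm _) (D t) De h1 h2 => a b d De h1 h2.
by rewrite ltr_norml; apply/andP; split; lra.
Qed.

Lemma smooth_fun_derivable (f : R -> R) (x : R) : smooth_fun f -> is_derive x 1 f (derive1 f x).
Proof. by move=> /(_ 0%N x) /= h; rewrite derive1E; exact/derivableP. Qed.

Lemma smooth_fun_continuous_derive1 (f : R -> R) : smooth_fun f -> continuous (derive1 f).
Proof.
move=> /(_ 1%N) /= h x; apply: differentiable_continuous; apply/derivable1_diffP; exact: h.
Qed.

Lemma continuous_speed n (g : R -> 'M[R[i]]_n) : smooth_curve g ->
  continuous (fun t => spectral_norm (curve_derive g t)).
Proof.
move=> sg; apply: continuous_spectral_norm => i j; have [sR sI] := sg i j.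
by split=> t; under eq_fun do rewrite mxE /=; exact: smooth_fun_continuous_derive1.
Qed.

Lemma continuous_itv_integrable (f : R -> R) (a b : R) : continuous f ->
  lebesgue_measure.-integrable `[a, b] (EFin \o f).
Proof.
move=> cf; apply: continuous_compact_integrable; first exact: segment_compact.
exact: continuous_subspaceT.
Qed.

End SpectralNorm.

(** * Exponential curves and the upper bound on the distance *)

Section ExponentialCurve.
Context {R : realType}.
Implicit Types n m : nat.

Lemma smooth_trigsum n (z a b : 'I_n -> R) : smooth_fun (trigsum z a b).
Proof.
have h k : exists a' b', derive1n k (trigsum z a b) = trigsum z a' b'.
  elim: k => [|k [a' [b' IH]]]; first by exists a, b.
  exists (fun k => b' k * z k), (fun k => - (a' k * z k)).
  rewrite derive1nS IH; apply/funext => s; rewrite derive1E.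
  by have -> := @derive_val _ _ _ _ _ _ _ (is_derive_trigsum z a' b' s).
by move=> k x; have [a' [b' ->]] := h k; case: (is_derive_trigsum z a' b' x).
Qed.

Lemma derive1_trigsum n (z a b : 'I_n -> R) s : derive1 (trigsum z a b) s =
  trigsum z (fun k => b k * z k) (fun k => - (a k * z k)) s.
Proof.
by rewrite derive1E; have -> := @derive_val _ _ _ _ _ _ _ (is_derive_trigsum z a b s).
Qed.

Definition exp_curve n (U P : 'M[R[i]]_n) (z : 'I_n -> R) (t : R) : 'M[R[i]]_n :=
  U *m unitary_exp P z t.

Lemma exp_curveE n (U P : 'M[R[i]]_n) (z : 'I_n -> R) t :
  exp_curve U P z t = (U *m adjmx P) *m diag_mx (\row_k cis (t * z k)) *m P.
Proof. by rewrite /exp_curve /unitary_exp !mulmxA. Qed.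

Lemma Re_exp_curve n (U P : 'M[R[i]]_n) (z : 'I_n -> R) i j :
  (fun t => complex.Re (exp_curve U P z t i j)) =
  trigsum z (fun k => complex.Re ((U *m adjmx P) i k * P k j))
            (fun k => - complex.Im ((U *m adjmx P) i k * P k j)).
Proof.
apply/funext => t; rewrite exp_curveE mx_diag_entry raddf_sum; apply: eq_bigr => k _.
rewrite [(\row_k0 _) _ _]mxE /cis; case: (_ * P k j) => a b /=; ring.
Qed.

Lemma Im_exp_curve n (U P : 'M[R[i]]_n) (z : 'I_n -> R) i j :
  (fun t => complex.Im (exp_curve U P z t i j)) =
  trigsum z (fun k => complex.Im ((U *m adjmx P) i k * P k j))
            (fun k => complex.Re ((U *m adjmx P) i k * P k j)).
Proof.
apply/funext => t; rewrite exp_curveE mx_diag_entry raddf_sum; apply: eq_bigr => k _.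
rewrite [(\row_k0 _) _ _]mxE /cis; case: (_ * P k j) => a b /=; ring.
Qed.

Lemma smooth_exp_curve n (U P : 'M[R[i]]_n) (z : 'I_n -> R) :
  smooth_curve (exp_curve U P z).
Proof.
by move=> i j; rewrite Re_exp_curve Im_exp_curve; split; exact: smooth_trigsum.
Qed.

Lemma curve_derive_exp_curve n (U P : 'M[R[i]]_n) (z : 'I_n -> R) t :
  curve_derive (exp_curve U P z) t =
  (U *m adjmx P) *m diag_mx (\row_k ((0 +i* z k) * cis (t * z k))) *m P.
Proof.
apply/matrixP => i j; rewrite [LHS]mxE Re_exp_curve Im_exp_curve !derive1_trigsum.
rewrite mx_diag_entry; apply/eqP; rewrite eq_complex /= !raddf_sum.
apply/andP; split; apply/eqP; apply: eq_bigr => k _;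
  rewrite [(\row_k0 _) _ _]mxE /cis; case: (_ * P k j) => a b /=; ring.
Qed.

(** Unitary factors preserve lengths, and the diagonal factor of the derivative has entries of
    modulus [|z k|]. *)
Lemma speed_exp_curve n (U P : 'M[R[i]]_n) (z : 'I_n -> R) r t :
  U \is unitarymx -> P \is unitarymx -> 0 <= r -> (forall k, `|z k| <= r) ->
  spectral_norm (curve_derive (exp_curve U P z) t) <= r.
Proof.
move=> hU hP r0 hz; apply: spectral_norm_le => v v1.
apply: (@le_trans _ _ (r * euclid_norm v)); last by rewrite ler_piMr.
apply: le_sqrt_rdot => //; rewrite curve_derive_exp_curve -2!mulmxA.
rewrite (rdot_unitary _ _ (unitarymxM hU (adjmx_unitary hP))) -(rdot_unitary v v hP).
move: (P *m v) => y; rewrite /rdot mulr_sumr; apply: ler_sum => k _.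
rewrite mul_diag_mx !mxE /cis; case: (y k 0) => a b /=.
have hz2 : z k ^+ 2 <= r ^+ 2.
  by rewrite -[z k ^+ 2]real_normK ?num_real// lerXn2r ?nnegrE.
rewrite [leLHS](_ : _ = z k ^+ 2 * (a * a + b * b) * (cos (t * z k) ^+ 2 + sin (t * z k) ^+ 2)).
  by rewrite cos2Dsin2 mulr1 ler_wpM2r// -!expr2 addr_ge0 ?sqr_ge0.
ring.
Qed.

Lemma exp_curve_joins n (U P : 'M[R[i]]_n) (z : 'I_n -> R) :
  U \is unitarymx -> P \is unitarymx ->
  joining_curve U (U *m unitary_exp P z 1) (exp_curve U P z).
Proof.
move=> hU hP; split.
- exists [:: 1]; split; first by apply: itv_partition1; exact: ltr01.
  move=> k _; exists (exp_curve U P z); split; first exact: smooth_exp_curve.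
  by move=> t _.
- by move=> t _; apply: unitarymxM hU _; exact: unitary_exp_unitary.
- by rewrite /exp_curve (unitary_exp0 z hP) mulmx1.
- by [].
Qed.

Lemma lebesgue_itv01 : fine (lebesgue_measure `[0, 1 : R]%classic) = 1.
Proof. by rewrite lebesgue_measure_itv /= lte_fin ltr01 /= subr0. Qed.

Lemma length_exp_curve n (U P : 'M[R[i]]_n) (z : 'I_n -> R) r :
  U \is unitarymx -> P \is unitarymx -> 0 <= r -> (forall k, `|z k| <= r) ->
  curve_length (exp_curve U P z) <= r.
Proof.
move=> hU hP r0 hz; rewrite /curve_length.
rewrite -[leRHS]mulr1 -[X in r * X]lebesgue_itv01 -Rintegral_cst//.
apply: le_Rintegral => //.
- by apply: continuous_itv_integrable; apply: continuous_speed; exact: smooth_exp_curve.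
- by apply: continuous_itv_integrable => x; exact: cvg_cst.
- by move=> t _; exact: speed_exp_curve.
Qed.

Lemma dist_unitary_le n (U V : 'M[R[i]]_n) (a : R -> 'M[R[i]]_n) :
  joining_curve U V a -> dist_unitary U V <= curve_length a.
Proof.
move=> ha; apply: ge_inf; last by exists a.
by exists 0 => _ [b _ <-]; apply: Rintegral_ge0 => t _; exact: spectral_norm_ge0.
Qed.

Lemma joining_curve_exists n (U V : 'M[R[i]]_n) r :
  U \is unitarymx -> V \is unitarymx -> 0 <= r <= pi -> arc_close (cos r) U V ->
  exists2 a, joining_curve U V a & curve_length a <= r.
Proof.
move=> hU hV r0 hc; have [P [z [hP hz e]]] := unitary_exp_exists r0 hU hV hc.
exists (exp_curve U P z); last by case/andP: r0 => r0 _; exact: length_exp_curve.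
have -> : V = U *m unitary_exp P z 1 by rewrite -e mulmxA unitarymxKV// mul1mx.
exact: exp_curve_joins.
Qed.

Lemma arc_close_dist_unitary n (U V : 'M[R[i]]_n) r :
  U \is unitarymx -> V \is unitarymx -> 0 <= r <= pi -> arc_close (cos r) U V ->
  dist_unitary U V <= r.
Proof.
move=> hU hV r0 hc; have [a ha] := joining_curve_exists hU hV r0 hc.
by apply: le_trans; exact: dist_unitary_le.
Qed.

Lemma dist_unitary_ge0 n (U V : 'M[R[i]]_n) : U \is unitarymx -> V \is unitarymx ->
  0 <= dist_unitary U V.
Proof.
move=> hU hV; apply: lb_le_inf.
  have [|a ha _] := joining_curve_exists hU hV _ (arc_close_piN hU hV).
    by rewrite pi_ge0 lexx.
  by exists (curve_length a), a.
by move=> _ [b _ <-]; apply: Rintegral_ge0 => t _; exact: spectral_norm_ge0.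
Qed.

End ExponentialCurve.

(** * Increments bounded by integrals, piece by piece *)

Section IntegralComparison.
Context {R : realType}.
Notation mu := (@lebesgue_measure R).

Lemma integrable_itv_oo_cc (f : R -> R) (a b : R) :
  mu.-integrable `]a, b[ (EFin \o f) -> mu.-integrable `[a, b] (EFin \o f).
Proof.
move=> /integrableP[mf fi]; apply/integrableP; split.
  by apply/measurable_EFinP; apply: measurable_fun_itv_cc; apply/measurable_EFinP; exact: mf.
rewrite -integral_itv_obnd_cbnd -?integral_itv_bndo_bndc//.
  by apply: measurableT_comp => //.
apply/emeasurable_fun_itv_bndo_bndcP; exact: measurableT_comp.
Qed.

Lemma Rintegral_itv_oo_cc (f : R -> R) (a b : R) :
  mu.-integrable `]a, b[ (EFin \o f) ->
  \int[mu]_(t in `]a, b[) f t = \int[mu]_(t in `[a, b]) f t.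
Proof.
move=> fi; rewrite -Rintegral_itv_obnd_cbnd; first exact: Rintegral_itv_bndo_bndc.
apply: integrableS (integrable_itv_oo_cc fi) => //.
by apply: subset_itvr; rewrite bnd_simp.
Qed.

(** Meant for the speed of a curve, which agrees with that of a smooth extension only inside each
    piece: at a breakpoint the two-sided derivative may be a default value. The endpoints have
    measure zero. *)
Lemma integral_interior_eq (f h : R -> R) (a b : R) : continuous h ->
  (forall t, t \in `]a, b[ -> f t = h t) ->
  mu.-integrable `[a, b] (EFin \o f) /\
  \int[mu]_(t in `[a, b]) f t = \int[mu]_(t in `[a, b]) h t.
Proof.
move=> ch e.
have ih : mu.-integrable `]a, b[ (EFin \o h).
  apply: integrableS (continuous_itv_integrable a b ch) => //.
  exact: subset_itvW.
have jf : mu.-integrable `]a, b[ (EFin \o f).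
  apply: eq_integrable ih => // t; rewrite inE /= => /e ht.
  by rewrite /= ht.
split; first exact: integrable_itv_oo_cc.
rewrite -!Rintegral_itv_oo_cc//; apply: eq_Rintegral => t.
by rewrite inE => /e.
Qed.

(** The primitive [L] of [f] minus [F] has nonnegative derivative inside the interval, hence does
    not decrease. This way the derivative of [F] is never integrated. *)
Lemma increment_le_integral (f F : R -> R) (a b : R) : a < b -> continuous f ->
  (forall x, x \in `[a, b] -> {for x, continuous F}) ->
  (forall x, x \in `]a, b[ -> derivable F x 1 /\ derive1 F x <= f x) ->
  F b - F a <= \int[mu]_(t in `[a, b]) f t.
Proof.
move=> ab cf cF hF; pose L x := \int[mu]_(t in `[a, x]) f t.
have fi u := continuous_itv_integrable a u cf.
have dL x : x \in `]a, b[ -> derivable L x 1 /\ derive1 L x = f x.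
  rewrite in_itv /= => /andP[ax xb].
  by apply: (continuous_FTC1_closed xb (fi b) ax); exact: cf.
have LFab : (L - F) a <= (L - F) b.
  apply: (@ger0_derive1_le _ (L - F) a b _ _ true false).
  - move=> x hx; apply: derivableB; first by case: (dL x hx).
    by case: (hF x hx).
  - move=> x hx; have [dLx eL] := dL x hx; have [dFx eF] := hF x hx.
    by rewrite derive1E deriveB// -!derive1E eL subr_ge0.
  - have cL := parameterized_integral_continuous (ltW ab) (fi b).
    move=> x; apply: cvgB; first exact: cL.
    apply: continuous_in_subspaceT => y; rewrite inE; exact: cF.
  - by rewrite in_itv /= lexx ltW.
  - by rewrite in_itv /= lexx ltW.
  - exact: ltW.
have La : L a = 0 by rewrite /L set_itv1 Rintegral_set1.
move: LFab; rewrite !fctE La /L; lra.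
Qed.

Lemma integrable_setU (A B : set R) (f : R -> R) : measurable A -> measurable B ->
  [disjoint A & B] -> mu.-integrable A (EFin \o f) -> mu.-integrable B (EFin \o f) ->
  mu.-integrable (A `|` B) (EFin \o f).
Proof.
move=> mA mB AB /integrableP[mfA fA] /integrableP[mfB fB].
have mf : measurable_fun (A `|` B) (EFin \o f) by apply/measurable_funU.
apply/integrableP; split=> //; rewrite ge0_integral_setU//.
  exact: lte_add_pinfty.
exact: measurableT_comp.
Qed.

(** Induction on the breakpoints. Integrability is part of the conclusion because splitting the
    integral at [b] uses it on the whole interval. *)
Lemma piecewise_increment_le (f F : R -> R) (a : R) (s : seq R) :
  path <%R a s ->
  (forall k, (k < size s)%N ->
     let u := nth 1 (a :: s) k in let v := nth 1 (a :: s) k.+1 in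
     mu.-integrable `[u, v] (EFin \o f) /\
     F v - F u <= \int[mu]_(t in `[u, v]) f t) ->
  mu.-integrable `[a, last a s] (EFin \o f) /\
  F (last a s) - F a <= \int[mu]_(t in `[a, last a s]) f t.
Proof.
elim: s a => [|b s IH] a /=.
  move=> _ _; split; last by rewrite set_itv1 Rintegral_set1 subrr.
  have [|//] := @integral_interior_eq f (fun=> 0) a a (fun=> cvg_cst _).
  by move=> t; rewrite in_itv /= => /andP[/lt_trans h /h]; rewrite ltxx.
move=> /andP[ab bs] h; have /= [iab leab] := h 0%N isT.
have [//|ibc lebc] := IH b bs.
  move=> k ks; exact: (h k.+1).
have bc : b <= last b s.
  by have := itv_partition_le (conj bs (eqxx _) : itv_partition b (last b s) s).
have ibc' : mu.-integrable `]b, last b s] (EFin \o f).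
  by apply: integrableS ibc => //; apply: subset_itvr; rewrite bnd_simp.
have iac : mu.-integrable `[a, last b s] (EFin \o f).
  (* The second piece is taken open at [b] to make the union disjoint. *)
  have -> : `[a, last b s]%classic = `[a, b]%classic `|` `]b, last b s]%classic.
    by apply: itv_bndbnd_setU; rewrite bnd_simp// ltW.
  apply: integrable_setU => //; apply/disj_setPS => x /=.
  by rewrite !in_itv /= => -[/andP[_ xb] /andP[/lt_le_trans/(_ xb)]]; rewrite ltxx.
split => //.
have := Rintegral_itvB iac (x := b); rewrite !bnd_simp => /(_ (ltW ab) bc).
by rewrite -(Rintegral_itv_obnd_cbnd ibc') in lebc; lra.
Qed.

End IntegralComparison.

(** * The lower bound on the length of a curve *)

Section LengthLowerBound.
Context {R : realType}.
Implicit Types n m : nat.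
Notation mu := (@lebesgue_measure R).

Lemma rdot_mulmxE n (u x : 'cV[R[i]]_n) (A : 'M[R[i]]_n) : rdot u (A *m x) =
  \sum_i \sum_j
    ((complex.Re (u i 0) * complex.Re (x j 0) + complex.Im (u i 0) * complex.Im (x j 0)) * complex.Re (A i j)
   + (complex.Im (u i 0) * complex.Re (x j 0) - complex.Re (u i 0) * complex.Im (x j 0)) * complex.Im (A i j)).
Proof.
apply: eq_bigr => i _; rewrite !mxE !raddf_sum !mulr_sumr -big_split /=.
apply: eq_bigr => j _.
by case: (u i 0) (x j 0) (A i j) => [a b] [c d] [e f] /=; ring.
Qed.

Lemma is_derive_rdot n (u x : 'cV[R[i]]_n) (g : R -> 'M[R[i]]_n) (t : R) :
  smooth_curve g ->
  is_derive t 1 (fun s => rdot u (g s *m x)) (rdot u (curve_derive g t *m x)).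
Proof.
move=> sg; under [X in is_derive _ _ X _]eq_fun do rewrite rdot_mulmxE.
rewrite rdot_mulmxE.
pose F i j s :=
  ((complex.Re (u i 0) * complex.Re (x j 0) + complex.Im (u i 0) * complex.Im (x j 0)) * complex.Re (g s i j)
   + (complex.Im (u i 0) * complex.Re (x j 0) - complex.Re (u i 0) * complex.Im (x j 0)) * complex.Im (g s i j)).
have -> : (fun s => \sum_i \sum_j F i j s) = \sum_(i < n) \sum_(j < n) F i j.
  by apply/funext => s; rewrite fct_sumE; apply: eq_bigr => i _; rewrite fct_sumE.
apply: is_derive_sum => i; apply: is_derive_sum => j; rewrite !mxE /= /F.
have [sR sI] := sg i j; have dR := smooth_fun_derivable t sR.
have dI := smooth_fun_derivable t sI.
by apply: is_deriveD; apply: is_deriveZ.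
Qed.

(** The point [g t x] moves on the unit sphere with velocity orthogonal to its position. So only the
    component of [u] orthogonal to [g t x] counts, of squared length [1 - <u, g t x>^2]. *)
Lemma rdot_derive_bound n (u x : 'cV[R[i]]_n) (g : R -> 'M[R[i]]_n) (a b t : R) :
  smooth_curve g -> (forall s, s \in `[a, b] -> g s \is unitarymx) ->
  rdot u u = 1 -> rdot x x = 1 -> t \in `]a, b[ ->
  rdot u (curve_derive g t *m x) ^+ 2 <=
  (1 - rdot u (g t *m x) ^+ 2) * spectral_norm (curve_derive g t) ^+ 2.
Proof.
move=> sg gU u1 x1 tab.
have sub s : s \in `]a, b[ -> s \in `[a, b] by apply: subset_itvW.
have w1 : rdot (g t *m x) (g t *m x) = 1 by rewrite rdot_unitary// gU// sub.
(* The function [s |-> <g t x, g s x>] attains its maximum 1 on the interval at the interior point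
   [s = t]. *)
have orth : rdot (g t *m x) (curve_derive g t *m x) = 0.
  have ab : a <= b by move: tab; rewrite in_itv /= => /andP[/lt_trans h /h /ltW].
  have := @derive1_at_max _ (fun s => rdot (g t *m x) (g s *m x)) a b t ab _ tab _.
  have dw s := is_derive_rdot (g t *m x) x s sg.
  case=> [s _|s sab|_ e]; first by case: (dw s).
    have /andP[_] : -1 <= rdot (g t *m x) (g s *m x) <= 1.
      by apply: rdot_bound => //; rewrite rdot_unitary// gU// sub.
    by rewrite w1.
  by have [_ <-] := dw t; exact: e.
have := sphere_CS u (curve_derive g t *m x) w1.
rewrite orth mulr0 !subr0 u1 expr0n subr0 (rdotC (g t *m x) u) => h.
apply: le_trans h _; apply: ler_wpM2l.
  by rewrite subr_ge0; have := rdot_CS u (g t *m x); rewrite u1 w1 mul1r.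
have := @le_spectral_norm _ _ (curve_derive g t) x.
rewrite !euclid_normE x1 sqrtr1 lexx => /(_ isT) ?.
rewrite -[leLHS]sqr_sqrtr ?rdot_ge0//.
by rewrite lerXn2r ?nnegrE ?sqrtr_ge0 ?spectral_norm_ge0.
Qed.

Lemma mul_itvoo (k p : R) : 0 < k < 1 -> -1 <= p <= 1 -> -1 < k * p < 1.
Proof. by move=> /andP[k0 k1] /andP[p0 p1]; apply/andP; split; nra. Qed.

(* The factor [k < 1] keeps [acos] away from its singularities. *)
Lemma acos_increment_le n (u x : 'cV[R[i]]_n) (g : R -> 'M[R[i]]_n) (a b k : R) :
  smooth_curve g -> a < b -> (forall s, s \in `[a, b] -> g s \is unitarymx) ->
  rdot u u = 1 -> rdot x x = 1 -> 0 < k < 1 ->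
  acos (k * rdot u (g b *m x)) - acos (k * rdot u (g a *m x)) <=
  \int[mu]_(t in `[a, b]) spectral_norm (curve_derive g t).
Proof.
move=> sg ab gU u1 x1 k01; pose f t := rdot u (g t *m x).
have f1 t : t \in `[a, b] -> -1 < k * f t < 1.
  move=> tab; apply: mul_itvoo => //; apply: rdot_bound => //.
  by rewrite rdot_unitary// gU.
have df (t : R) : is_derive t 1 (fun s => k * f s) (k * rdot u (curve_derive g t *m x)).
  by apply: is_deriveZ; exact: is_derive_rdot.
apply: (@increment_le_integral _ _ (acos \o (fun s => k * f s))) => //.
- exact: continuous_speed.
- move=> t tab; apply: continuous_comp; last exact: continuous_acos (f1 t tab).
  apply: differentiable_continuous; apply/derivable1_diffP.
  by case: (df t).
- move=> t tab.
  have kf : -1 < k * f t < 1 by apply: f1; exact: subset_itvW tab.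
  have [dF eF] :=
    @is_derive1_comp _ (@acos R) (fun s => k * f s) t _ _ (is_derive1_acos kf) (df t).
  split; first exact: dF.
  rewrite derive1E eF; have := rdot_derive_bound sg gU u1 x1 tab.
  rewrite -/(f t); move: kf (spectral_norm_ge0 (curve_derive g t)).
  move: (spectral_norm _) (rdot u _) (f t) => N d p kp N0 h.
  have s0 : 0 < 1 - (k * p) ^+ 2 by case/andP: kp => *; nra.
  have S0 : 0 < Num.sqrt (1 - (k * p) ^+ 2) by rewrite sqrtr_gt0.
  rewrite mulNr mulrC -mulNr ler_pdivrMr//.
  (* Squaring leaves [(k d)^2 <= (1 - (k p)^2) N^2], which follows from [d^2 <= (1 - p^2) N^2] and
     [k^2 <= 1]. *)
  apply: le_trans (ler_norm _) _; rewrite normrN.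
  rewrite -(ler_pXn2r (n := 2)) ?nnegrE ?(mulr_ge0 N0 (ltW S0))// real_normK ?num_real//.
  rewrite !exprMn sqr_sqrtr; last by rewrite -exprMn ltW.
  have : k ^+ 2 <= 1 by case/andP: k01 => *; nra.
  have := sqr_ge0 k; have := sqr_ge0 N.
  move: (N ^+ 2) (d ^+ 2) (p ^+ 2) (k ^+ 2) h => n2 d2 p2 k2 h n0 k0 k1.
  by have := ler_wpM2l k0 h; have := ler_wpM2l n0 k1; lra.
Qed.

Lemma curve_derive_eq n (a g : R -> 'M[R[i]]_n) (u v t : R) :
  (forall s, u <= s <= v -> a s = g s) -> t \in `]u, v[ ->
  curve_derive a t = curve_derive g t.
Proof.
move=> ag tuv; have ne : \near t, a t = g t.
  have := near_in_itvoo tuv; apply: filterS => s; rewrite in_itv /= => /andP[us sv].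
  by apply: ag; rewrite !ltW.
apply/matrixP => i j; rewrite !mxE !derive1E.
by congr (_ +i* _); apply: near_eq_derive; apply: filterS ne => s ->.
Qed.

(** The term [acos k] is the value at the start, where [<Ux, Ux> = 1]. As [k] tends to 1, the left
    side tends to the angle between [Ux] and [Vx]. *)
Lemma acos_le_length n (U V : 'M[R[i]]_n) (a : R -> 'M[R[i]]_n) x (k : R) :
  U \is unitarymx -> joining_curve U V a -> rdot x x = 1 -> 0 < k < 1 ->
  acos (k * rdot (U *m x) (V *m x)) - acos k <= curve_length a.
Proof.
move=> hU [[s [hs ps]] aU a0 a1] x1 k01.
have u1 : rdot (U *m x) (U *m x) = 1 by rewrite rdot_unitary.
pose F t := acos (k * rdot (U *m x) (a t *m x)).
have -> : acos (k * rdot (U *m x) (V *m x)) - acos k = F 1 - F 0.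
  by rewrite /F a0 a1 u1 mulr1.
have [spath /eqP slast] := hs.
rewrite /curve_length -slast.
have [|//] := @piecewise_increment_le _ (fun t => spectral_norm (curve_derive a t)) F 0 s spath.
move=> i si /=; have [g [sg /= ag]] := ps i si.
have uv : nth 1 (0 :: s) i < nth 1 s i by move/(pathP 1): spath; exact.
have u0 : 0 <= nth 1 (0 :: s) i by apply: itv_partition_nth_ge hs; rewrite ltnS ltnW.
have v1 : nth 1 s i <= 1 by apply: (itv_partition_nth_le (m := i.+1) _ hs).
move: (nth 1 (0 :: s) i) (nth 1 s i) ag uv u0 v1 => u v /= ag uv u0 v1.
have e t : t \in `]u, v[ -> spectral_norm (curve_derive a t) = spectral_norm (curve_derive g t).
  by move=> tuv; rewrite (curve_derive_eq ag tuv).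
have [ia ->] := integral_interior_eq (continuous_speed sg) e; split=> //.
have uu : u <= u <= v by rewrite lexx ltW.
have vv : u <= v <= v by rewrite lexx ltW.
rewrite /F (ag _ uu) (ag _ vv).
apply: (acos_increment_le sg uv _ u1 x1 k01) => t; rewrite in_itv /= => tuv.
rewrite -(ag t tuv); apply: aU; case/andP: tuv => ut tv.
by apply/andP; split; [exact: le_trans u0 ut|exact: le_trans tv v1].
Qed.

(** The infimum is approached by a curve of length below [r + e]. With [k = cos e], [acos_le_length]
    gives [acos (cos e * p) <= r + 2 e], and [e] then tends to 0. *)
Lemma dist_unitary_close n (U V : 'M[R[i]]_n) (r : R) :
  U \is unitarymx -> V \is unitarymx -> 0 <= r < pi -> dist_unitary U V <= r ->
  arc_close (cos r) U V.
Proof.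
move=> hU hV /andP[r0 rpi] dr; apply: arc_close_unit => x x1.
set p := rdot _ _; have p1 : -1 <= p <= 1 by apply: rdot_bound; rewrite rdot_unitary.
pose h e := cos e * p - cos (r + e + e).
have ch : continuous h.
  move=> e; apply: cvgB.
    by apply: cvgM; [exact: continuous_cos|exact: cvg_cst].
  apply: (@continuous_comp _ _ _ (fun e => r + e + e) cos); last exact: continuous_cos.
  by apply: cvgD; [apply: cvgD; [exact: cvg_cst|exact: cvg_id]|exact: cvg_id].
suff : 0 <= h 0 by rewrite /h cos0 mul1r !addr0 subr_ge0.
apply: ge_limit_dyadic; first exact: ch.
(* The second bound keeps [r + 2 e <= pi], where the cosine still decreases; the first keeps [e]
   below [pi / 2], so that [0 < cos e < 1]. *)
move=> m; pose d := Num.min 2^-1 ((pi - r) / 2); have pi2 := @pihalf_ge1 R.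
have d0 : 0 < d by rewrite lt_min invr_gt0 ltr0n divr_gt0// subr_gt0.
have d1 : d <= 2^-1 by rewrite ge_min lexx.
have d2 : d <= (pi - r) / 2 by rewrite ge_min lexx orbT.
have m0 : 0 < 2^-1 ^+ m :> R by rewrite exprn_gt0 ?invr_gt0.
have m1 : 2^-1 ^+ m <= 1 :> R by rewrite exprn_ile1 ?invr_ge0 ?invf_le1 ?ler1n.
pose e := 2^-1 ^+ m * d.
have e0 : 0 < e by rewrite mulr_gt0.
have em : e <= 2^-1 ^+ m by rewrite ler_piMr ?(ltW m0)//; lra.
have ed : e <= d by rewrite ler_piMl ?(ltW d0).
exists e; split; first by rewrite sub0r normrN gtr0_norm.
have [||L [a ha <-] ale] := @inf_lt R [set curve_length a | a in joining_curve U V] (r + e).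
- have [|a ha _] := joining_curve_exists hU hV _ (arc_close_piN hU hV).
    by rewrite pi_ge0 lexx.
  by exists (curve_length a), a.
- by apply: le_lt_trans dr _; rewrite ltrDl.
have ce : 0 < cos e < 1.
  rewrite cos_gt0_pihalf ?andTb; last by apply/andP; split; lra.
  by rewrite -cos0 ltr_cos// in_itv /=; apply/andP; split; lra.
have := acos_le_length hU ha x1 ce; rewrite -/p.
rewrite (cosK (x := e)); last by rewrite in_itv /=; apply/andP; split; lra.
have kp : -1 <= cos e * p <= 1 by have /andP[? ?] := mul_itvoo ce p1; rewrite !ltW.
move=> al; rewrite subr_ge0 -[leRHS]acosK ?in_itv//.
rewrite ler_cos; first by lra.
  by rewrite in_itv /= acos_ge0 ?acos_lepi.
by rewrite in_itv /=; apply/andP; split; lra.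
Qed.

End LengthLowerBound.

(** * Generators of geodesics and the triangle inequality *)

Section Generators.
Context {R : realType}.
Implicit Types n : nat.

Lemma hermsymmxE n (Z : 'M[R[i]]_n) : (Z \is hermsymmx) <-> adjmx Z = Z.
Proof.
rewrite -adjmxE; split=> [/is_hermitianmxP|] h.
  by rewrite {2}h expr0 scale1r.
by apply/is_hermitianmxP; rewrite expr0 scale1r h.
Qed.

(** A Hermitian matrix is normal, and self-adjointness makes its eigenvalues real. Testing the norm
    on the unit vector [P^* e_k] bounds [|z k|]. *)
Lemma hermsymmx_diag n (Z : 'M[R[i]]_n) : Z \is hermsymmx ->
  exists P : 'M[R[i]]_n, exists z : 'I_n -> R, [/\ P \is unitarymx,
    Z = adjmx P *m diag_mx (\row_k (z k)%:C) *m P &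
    forall k, `|z k| <= spectral_norm Z].
Proof.
move=> /hermsymmxE hZ.
have [|P [d [hP e]]] := @normal_diag _ n Z; first by rewrite hZ.
have ed : diag_mx d = P *m Z *m adjmx P.
  by rewrite e !mulmxA unitarymxKV// mul1mx -mulmxA unitarymxKV// mulmx1.
have dreal k : d 0 k = (complex.Re (d 0 k))%:C.
  have : adjmx (diag_mx d) = diag_mx d.
    by rewrite ed !adjmxM adjmxK hZ mulmxA.
  rewrite adjmx_diag => /matrixP/(_ k k); rewrite !mxE eqxx !mulr1n.
  by case: (d 0 k) => a b /= [] h; apply/eqP; rewrite eq_complex /= eqxx/=; apply/eqP; lra.
exists P, (fun k => complex.Re (d 0 k)); split; [exact: hP| |move=> k].
  rewrite e; have {1}-> // : d = \row_k (complex.Re (d 0 k))%:C.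
  by apply/rowP => k; rewrite mxE dreal.
have := @le_spectral_norm _ _ Z (adjmx P *m delta_mx k 0).
rewrite !euclid_normE (rdot_unitary _ _ (adjmx_unitary hP)) rdot_delta sqrtr1.
rewrite lexx => /(_ isT); apply: le_trans.
rewrite {1 2}e -!mulmxA (mulmxA P) unitarymxKV// mul1mx.
rewrite (rdot_unitary _ _ (adjmx_unitary hP)) mul_diag_mx.
rewrite -sqrtr_sqr ler_sqrt ?rdot_ge0// /rdot (bigD1 k)//= !mxE !eqxx mulr1 dreal /=.
rewrite mulr0 addr0 expr2 lerDl; apply: sumr_ge0 => j _.
by rewrite -!expr2 addr_ge0 ?sqr_ge0.
Qed.

Lemma geodesic_generator_exists n (W0 W1 : 'M[R[i]]_n) r :
  W0 \is unitarymx -> W1 \is unitarymx -> 0 <= r < pi -> arc_close (cos r) W0 W1 ->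
  exists Z, geodesic_generator W0 W1 Z.
Proof.
move=> h0 h1 /andP[r0 rpi] hc.
have [|P [z [hP hz e]]] := unitary_exp_exists _ h0 h1 hc; first by rewrite r0 ltW.
exists (adjmx P *m diag_mx (\row_k (z k)%:C) *m P); split.
- apply/hermsymmxE; rewrite !adjmxM adjmxK mulmxA adjmx_diag.
  congr (_ *m diag_mx _ *m _); apply/rowP => k; rewrite !mxE.
  by apply/eqP; rewrite eq_complex /= oppr0 !eqxx.
- apply: le_lt_trans rpi; apply: spectral_norm_le => v v1.
  apply: (@le_trans _ _ (r * euclid_norm v)); last by rewrite ler_piMr.
  apply: le_sqrt_rdot => //; rewrite -2!mulmxA.
  rewrite (rdot_unitary _ _ (adjmx_unitary hP)) -(rdot_unitary v v hP).
  move: (P *m v) => y; rewrite /rdot mulr_sumr; apply: ler_sum => k _.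
  rewrite mul_diag_mx !mxE; case: (y k 0) => a b /=.
  have hz2 : z k ^+ 2 <= r ^+ 2.
    by rewrite -[z k ^+ 2]real_normK ?num_real// lerXn2r ?nnegrE.
  rewrite [leLHS](_ : _ = z k ^+ 2 * (a * a + b * b)); last by ring.
  by rewrite ler_wpM2r// -!expr2 addr_ge0 ?sqr_ge0.
- by rewrite expmx_diag// adjmxE -e.
Qed.

(** Puts an arbitrary generator in spectral form, so that every geodesic from [W0] to [W1] is
    covered, whatever the choice of [Z]. *)
Lemma geodesicE n (W0 W1 Z : 'M[R[i]]_n) :
  W0 \is unitarymx -> geodesic_generator W0 W1 Z ->
  exists P : 'M[R[i]]_n, exists z : 'I_n -> R,
    [/\ P \is unitarymx, forall k, `|z k| < pi,
        W1 = W0 *m unitary_exp P z 1 &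
        forall s, geodesic W0 Z s = W0 *m unitary_exp P z s].
Proof.
move=> h0 [hZ nZ eZ]; have [P [z [hP e hz]]] := hermsymmx_diag hZ.
exists P, z; split; first exact: hP.
- by move=> k; apply: le_lt_trans (hz k) nZ.
- move: eZ; rewrite e expmx_diag// adjmxE => ->.
  by rewrite mulmxA unitarymxKV// mul1mx.
- by move=> s; rewrite /geodesic e expmx_diag.
Qed.

(** Derived from the triangle inequality for angles instead of joining curves end to end, hence the
    bound by [pi] on the sum. *)
Lemma dist_unitary_triangle n (U V W : 'M[R[i]]_n) :
  U \is unitarymx -> V \is unitarymx -> W \is unitarymx ->
  dist_unitary U W + dist_unitary W V < pi ->
  dist_unitary U V <= dist_unitary U W + dist_unitary W V.
Proof.
move=> hU hV hW; have := dist_unitary_ge0 hU hW; have := dist_unitary_ge0 hW hV.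
have := @dist_unitary_close _ _ U W (dist_unitary U W) hU hW.
have := @dist_unitary_close _ _ W V (dist_unitary W V) hW hV.
move: (dist_unitary U W) (dist_unitary W V) => a b hb ha b0 a0 ab.
have ca : arc_close (cos a) U W by apply: ha => //; apply/andP; split; lra.
have cb : arc_close (cos b) W V by apply: hb => //; apply/andP; split; lra.
apply: arc_close_dist_unitary => //; first by apply/andP; split; lra.
by apply: arc_close_trans ca cb => //; lra.
Qed.

End Generators.

(** * The intermediate set as an intersection of two convex balls *)

Theorem proposition5p4 (R : realType) (n : nat) (U V : 'M[R[i]]_n) (t : R)
    (hU : U \is unitarymx) (hV : V \is unitarymx)
    (hUV : dist_unitary U V < pi / 2)
    (ht : 0 < t < 1) :
  geodesically_convex (intermediate_set t U V).
Proof.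
have d0 := dist_unitary_ge0 hU hV.
have := dist_unitary_triangle hU hV; rewrite /intermediate_set.
move: (dist_unitary U V) hUV d0 => d dpi d0 triangle W0 W1 /=.
have eqle (x y : R) : x = y -> x <= y by move->.
have pi0 := @pi_gt0 R; case/andP: ht => t0 t1.
have rpi : 0 <= t * d < pi / 2 by apply/andP; split; nra.
have r'pi : 0 <= (1 - t) * d < pi / 2 by apply/andP; split; nra.
have wpi (r : R) : 0 <= r < pi / 2 -> 0 <= r < pi by move=> /andP[? ?]; apply/andP; split; lra.
have cpos (r : R) : 0 <= r < pi / 2 -> 0 < cos r.
  by move=> /andP[? ?]; apply: cos_gt0_pihalf; apply/andP; split; lra.
move=> [h0 dU0 d0V] [h1 dU1 d1V].
have cU0 := dist_unitary_close hU h0 (wpi _ rpi) (eqle _ _ dU0).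
have cU1 := dist_unitary_close hU h1 (wpi _ rpi) (eqle _ _ dU1).
have cV0 := arc_closeC (dist_unitary_close h0 hV (wpi _ r'pi) (eqle _ _ d0V)).
have cV1 := arc_closeC (dist_unitary_close h1 hV (wpi _ r'pi) (eqle _ _ d1V)).
split.
  case/andP: (rpi) => r0 rlt.
  (* Both points are within [t d] of [U], hence within [2 t d < pi] of each other, which provides a
     generator. *)
  have c01 : arc_close (cos (t * d + t * d)) W0 W1.
    by apply: (arc_close_trans h0 h1 hU r0 r0 _ (arc_closeC cU0) cU1); lra.
  by apply: (geodesic_generator_exists h0 h1 _ c01); apply/andP; split; lra.
move=> Z hZ s s01; have [P [z [hP hz e1 ->]]] := geodesicE h0 hZ.
rewrite e1 in cU1 cV1.
have hW : W0 *m unitary_exp P z s \is unitarymx.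
  by apply: unitarymxM h0 _; exact: unitary_exp_unitary.
have cU := arc_close_geodesic hU h0 hP (cpos _ rpi) hz cU0 cU1 s01.
have cV := arc_closeC (arc_close_geodesic hV h0 hP (cpos _ r'pi) hz cV0 cV1 s01).
have le_pi (r : R) : 0 <= r < pi / 2 -> 0 <= r <= pi by move=> /andP[? ?]; apply/andP; split; lra.
have dU := arc_close_dist_unitary hU hW (le_pi _ rpi) cU.
have dV := arc_close_dist_unitary hW hV (le_pi _ r'pi) cV.
(* The distances to [U] and [V] are at most [t d] and [(1 - t) d]; as their sum is at least [d],
   both are equalities. *)
have := triangle _ hW; move: dU dV.
move: (dist_unitary U _) (dist_unitary _ V) => a b ha hb hab.
have {hab} : d <= a + b by apply: hab; lra.
by split; [exact: hW|lra|lra].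
Qed.
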